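(* (i) For every integer $n\ge 2$, $mon_2(K_n\Box K_n)=n$. (ii) Let $k$ be a positive integer and $t$ a positive even integer, and let $n=k\frac{t}{2}$. Then $mon_t(K_n\Box K_n)=k\frac{t^2}{4}$. (iii) With $k,t,n$ as in (ii), $mon_{2n-t}(K_n\Box K_n)=k(k-1)\frac{t^2}{4}$.
   Context: $K_n$ is the complete graph on $n$ vertices. The Cartesian product $G\Box H$ has vertex set $V(G)\times V(H)$, with $(u,v)$ adjacent to $(u',v')$ iff either $u=u'$ and $vv'\in E(H)$, or $v=v'$ and $uu'\in E(G)$. For a graph $G$ and constant threshold $t$ (at most every vertex degree), a set $M\subseteq V(G)$ is a $t$-monopoly if every vertex outside $M$ has at least $t$ neighbors in $M$; $mon_t(G)$ is the minimum size of a $t$-monopoly. *)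

(* Defs.v *)
From mathcomp Require Import all_boot.

Set Implicit Arguments.
Unset Strict Implicit.
Unset Printing Implicit Defensive.

Record sgraph := SGraph {
  vertex :> finType;
  adj : rel vertex;
  adj_sym : symmetric adj;
  adj_irrefl : irreflexive adj
}.

Section CompleteGraph.
Variable n : nat.

Definition complete_rel : rel 'I_n := fun u v => u != v.

Lemma complete_sym : symmetric complete_rel.
Proof. by move=> u v; rewrite /complete_rel eq_sym. Qed.

Lemma complete_irrefl : irreflexive complete_rel.
Proof. by move=> u; rewrite /complete_rel eqxx. Qed.

Definition complete_graph : sgraph := SGraph complete_sym complete_irrefl.
End CompleteGraph.

Section CartesianProduct.
Variables G H : sgraph.

Definition cart_rel : rel (G * H)%type := fun x y =>
  (x.1 == y.1) && adj x.2 y.2 || (x.2 == y.2) && adj x.1 y.1.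

Lemma cart_sym : symmetric cart_rel.
Proof.
move=> x y.
by rewrite /cart_rel (eq_sym x.1) (eq_sym x.2) (adj_sym x.1) (adj_sym x.2).
Qed.

Lemma cart_irrefl : irreflexive cart_rel.
Proof. by move=> x; rewrite /cart_rel !adj_irrefl !andbF. Qed.

Definition cart_prod : sgraph := SGraph cart_sym cart_irrefl.
End CartesianProduct.

Section Monopoly.
Variables (G : sgraph) (t : nat).

Definition neighbors (v : G) : {set G} := [set u | adj v u].

Definition monopoly (M : {set G}) : bool :=
  [forall v, (v \notin M) ==> (t <= #|neighbors v :&: M|)].

Lemma monopolyT : monopoly [set: G].
Proof. by apply/forallP => v; rewrite in_setT. Qed.

(* The minimum ranges over a nonempty family, by [monopolyT], even if [t]
   exceeds some vertex degrees. *)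
Definition mon : nat := #|[arg min_(M < [set: G] | monopoly M) #|M|]|.

Lemma monP :
  (exists2 M, monopoly M & #|M| = mon) /\ (forall M, monopoly M -> mon <= #|M|).
Proof.
rewrite /mon; case: arg_minnP => [|M monM minM]; first exact: monopolyT.
by split; first by exists M.
Qed.
End Monopoly.

Arguments mon : clear implicits.

(* Main.v *)
Require Import Defs.
From mathcomp Require Import all_boot.
From mathcomp Require Import fingroup zmodp zify.

Set Implicit Arguments.
Unset Strict Implicit.
Unset Printing Implicit Defensive.

(** Let [r_a] and [c_b] be the row and column sizes of a set [M] of cells of an
    [A * B] grid.  A cell outside [M] has [r_a + c_b] neighbours in [M], so [M]
    is a [t]-monopoly iff [r_a + c_b >= t] off [M].

    Lower bound for [t <= n]: if all rows, or all columns, have at least [t / 2]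
    cells, we are done; otherwise take a line of least size [r], say a row, and
    count [M] by columns according to whether they meet that row in [M].

    Lower bound for [2n - t]: in the complement [N] of [M], [r_a + c_b <= t] at
    each cell of [N].  Summing over [N] gives
    [\sum r_a ^ 2 + \sum c_b ^ 2 <= t * #|N|], and Cauchy-Schwarz concludes.

    Both bounds are attained by the cells of a Cayley table whose entries lie in
    a fixed set of [s] group elements: a Cayley table is a Latin square, so each
    row and column contains [s] of them.

    For [k = 1] in (ii) the threshold [2n] exceeds all degrees, so that only the
    set of all vertices is a monopoly. *)

Lemma sqr_sum_leq (I : finType) (f : I -> nat) :
  (\sum_i f i) ^ 2 <= #|I| * \sum_i f i ^ 2.
Proof.
have double_sum :
    2 * (\sum_i f i) ^ 2 <= \sum_i \sum_j (f i ^ 2 + f j ^ 2).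
  rewrite -mulnn big_distrlr big_distrr /=.
  apply: leq_sum => i _; rewrite big_distrr /=.
  by apply: leq_sum => j _; apply: nat_Cauchy.
rewrite -(leq_pmul2l (ltn0Sn 1)); apply: leq_trans double_sum _.
under eq_bigr do rewrite big_split /= sum_nat_const.
by rewrite big_split sum_nat_const -big_distrr /= addnn mul2n.
Qed.

Section RowsAndColumns.
Variables A B : finType.
Implicit Types M N : {set A * B}.

Definition row_set M (a : A) : {set B} := [set b | (a, b) \in M].
Definition col_set M (b : B) : {set A} := [set a | (a, b) \in M].

(* The row and the column through [(a, b)] form a cross. *)
Definition cross_dominating t M : Prop :=
  forall a b, (a, b) \notin M -> t <= #|row_set M a| + #|col_set M b|.

Lemma row_setT a : row_set setT a = setT.
Proof. by apply/setP => b; rewrite !inE. Qed.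

Lemma col_setT b : col_set setT b = setT.
Proof. by apply/setP => a; rewrite !inE. Qed.

Lemma row_setC M a : row_set (~: M) a = ~: row_set M a.
Proof. by apply/setP => b; rewrite !inE. Qed.

Lemma col_setC M b : col_set (~: M) b = ~: col_set M b.
Proof. by apply/setP => a; rewrite !inE. Qed.

Lemma sum_row_set M (F : A -> nat) :
  \sum_(p in M) F p.1 = \sum_a #|row_set M a| * F a.
Proof.
under [RHS]eq_bigr do rewrite -sum_nat_const.
by rewrite pair_big_dep; apply: eq_bigl => -[a b]; rewrite inE.
Qed.

Lemma sum_col_set M (F : B -> nat) :
  \sum_(p in M) F p.2 = \sum_b #|col_set M b| * F b.
Proof.
under [RHS]eq_bigr do rewrite -sum_nat_const.
rewrite (exchange_big_dep xpredT) //= pair_big_dep.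
by apply: eq_bigl => -[a b]; rewrite inE.
Qed.

Lemma card_sum_row_set M : #|M| = \sum_a #|row_set M a|.
Proof.
by rewrite -sum1_card (sum_row_set M (fun=> 1)); under eq_bigr do rewrite muln1.
Qed.

Lemma card_sum_col_set M : #|M| = \sum_b #|col_set M b|.
Proof.
by rewrite -sum1_card (sum_col_set M (fun=> 1)); under eq_bigr do rewrite muln1.
Qed.

Lemma leq_card_row_set M s :
  (forall a, s <= 2 * #|row_set M a|) -> #|A| * s <= 2 * #|M|.
Proof.
move=> row_ge; rewrite -sum_nat_const card_sum_row_set big_distrr /=.
exact: leq_sum.
Qed.

(* With [r := #|row_set M a|], the [#|B| - r] columns [b] with [(a, b)] not in
   [M] have at least [t - r] cells and the others at least [r]; moreover
   [2 * ((#|B| - r) * (t - r) + r ^ 2) - #|B| * t = (#|B| - 2r) * (t - 2r)]. *)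
Lemma leq_card_short_row M t a :
    t <= #|B| -> cross_dominating t M -> 2 * #|row_set M a| <= t ->
    (forall b, #|row_set M a| <= #|col_set M b|) ->
  #|B| * t <= 2 * #|M|.
Proof.
move=> t_B domM; set r := #|row_set M a| => r_t r_min.
have row_card : \sum_b (b \in row_set M a) * (t - 2 * r) = r * (t - 2 * r).
  by rewrite -big_distrl /= -big_mkcond sum1_card.
have sum_cols : #|B| * (t - r) <= #|M| + r * (t - 2 * r).
  rewrite card_sum_col_set -row_card -big_split -sum_nat_const /=.
  apply: leq_sum => b _; rewrite inE; have := r_min b.
  by case: (boolP (_ \in M)) => [_|/domM]; rewrite -/r /=; lia.
have width_ge : 2 * r * (t - 2 * r) <= #|B| * (t - 2 * r).
  by rewrite leq_mul2r (leq_trans r_t) ?orbT.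
nia.
Qed.

Lemma leq_card_shortest_row M t a :
    t <= minn #|A| #|B| -> cross_dominating t M ->
    (forall a', #|row_set M a| <= #|row_set M a'|) ->
    (forall b, #|row_set M a| <= #|col_set M b|) ->
  minn #|A| #|B| * t <= 2 * #|M|.
Proof.
rewrite leq_min => /andP[_ t_B] domM row_min col_min.
case: (leqP t (2 * #|row_set M a|)) => [t_row | /ltnW row_t].
  apply: leq_trans (leq_mul (geq_minl _ _) (leqnn t)) _.
  apply: leq_card_row_set => a'.
  by rewrite (leq_trans t_row) // leq_mul2l row_min.
apply: leq_trans (leq_mul (geq_minr _ _) (leqnn t)) _.
exact: leq_card_short_row row_t col_min.
Qed.

Lemma leq_card_light_crosses N t :
    (forall a b, (a, b) \in N -> #|row_set N a| + #|col_set N b| <= t) ->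
  #|N| * (#|A| + #|B|) <= t * (#|A| * #|B|).
Proof.
move=> light.
have sum_sqr :
    \sum_a #|row_set N a| ^ 2 + \sum_b #|col_set N b| ^ 2 <= #|N| * t.
  rewrite -(sum_row_set N (fun a => #|row_set N a|)).
  rewrite -(sum_col_set N (fun b => #|col_set N b|)).
  rewrite -big_split -sum_nat_const /=.
  by apply: leq_sum => -[a b] /light.
case: (posnP #|N|) => [-> // | N_gt0].
have row_sqr := sqr_sum_leq (fun a => #|row_set N a|).
have col_sqr := sqr_sum_leq (fun b => #|col_set N b|).
rewrite -card_sum_row_set in row_sqr; rewrite -card_sum_col_set in col_sqr.
rewrite -(leq_pmul2l N_gt0).
have := leq_mul row_sqr (leqnn #|B|); have := leq_mul col_sqr (leqnn #|A|).
have := leq_mul sum_sqr (leqnn (#|A| * #|B|)); lia.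
Qed.

Lemma leq_cardC_cross_dominating M t :
    cross_dominating (#|A| + #|B| - t) M ->
  #|~: M| * (#|A| + #|B|) <= t * (#|A| * #|B|).
Proof.
move=> domM; apply: leq_card_light_crosses => a b.
rewrite inE row_setC col_setC => /domM.
by have := cardsC (row_set M a); have := cardsC (col_set M b); lia.
Qed.

End RowsAndColumns.

Section Transposition.
Variables (A B : finType) (M : {set A * B}).

Definition transpose : {set B * A} := swap_pair @^-1: M.

Lemma row_set_transpose b : row_set transpose b = col_set M b.
Proof. by apply/setP => a; rewrite !inE. Qed.

Lemma col_set_transpose a : col_set transpose a = row_set M a.
Proof. by apply/setP => b; rewrite !inE. Qed.

Lemma card_transpose : #|transpose| = #|M|.
Proof.
rewrite card_sum_row_set card_sum_col_set.
by under eq_bigr do rewrite row_set_transpose.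
Qed.

Lemma cross_dominating_transpose t :
  cross_dominating t M -> cross_dominating t transpose.
Proof.
move=> domM b a; rewrite inE row_set_transpose col_set_transpose addnC.
exact: domM.
Qed.

End Transposition.

Lemma leq_card_cross_dominating (A B : finType) (M : {set A * B}) t :
    t <= minn #|A| #|B| -> cross_dominating t M ->
  minn #|A| #|B| * t <= 2 * #|M|.
Proof.
move=> t_AB domM; case: (posnP (minn #|A| #|B|)) => [-> // |].
rewrite leq_min => /andP[/card_gt0P[a0 _] /card_gt0P[b0 _]].
have [a _ a_min] := @arg_minnP _ a0 predT (fun a => #|row_set M a|) isT.
have [b _ b_min] := @arg_minnP _ b0 predT (fun b => #|col_set M b|) isT.
case: (leqP #|row_set M a| #|col_set M b|) => [row_col | /ltnW col_row].
  apply: (leq_card_shortest_row (a := a)) => // [a'|b']; first exact: a_min.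
  exact: leq_trans row_col (b_min b' isT).
rewrite -card_transpose minnC.
apply: (leq_card_shortest_row (a := b)) => [||b'|a'].
- by rewrite minnC.
- exact: cross_dominating_transpose.
- by rewrite !row_set_transpose b_min.
- by rewrite row_set_transpose col_set_transpose (leq_trans col_row) ?a_min.
Qed.

Section CayleyTable.
Variables (gT : finGroupType) (S : {set gT}).

Definition cayley_table_set : {set gT * gT} := [set p | (p.1 * p.2)%g \in S].

Lemma card_row_cayley_table_set x : #|row_set cayley_table_set x| = #|S|.
Proof.
rewrite -(card_preimset S (mulgI x)).
by apply: eq_card => y; rewrite !inE.
Qed.

Lemma card_col_cayley_table_set y : #|col_set cayley_table_set y| = #|S|.
Proof.
rewrite -(card_preimset S (mulIg y)).
by apply: eq_card => x; rewrite !inE.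
Qed.

End CayleyTable.

Lemma exists_regular_set n s : s <= n ->
  exists M : {set 'I_n * 'I_n},
    (forall i, #|row_set M i| = s) /\ (forall j, #|col_set M j| = s).
Proof.
case: n => [|n] s_n; first by exists set0; split; case.
have : 0 < #|[set S : {set 'I_n.+1} | #|S| == s]|.
  by rewrite card_draws card_ord bin_gt0.
case/card_gt0P => S; rewrite inE => /eqP <-.
exists (cayley_table_set S); split.
  exact: card_row_cayley_table_set.
exact: card_col_cayley_table_set.
Qed.

Section MonopolySize.
Variables (G : sgraph) (t : nat).

Lemma mon_leq (M : {set G}) : monopoly t M -> mon G t <= #|M|.
Proof. exact: (monP G t).2. Qed.

Lemma mon_geq s :
  (forall M : {set G}, monopoly t M -> s <= #|M|) -> s <= mon G t.
Proof. by have [[M monM <-] _] := monP G t; apply. Qed.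

Lemma monopoly_gt_degree (M : {set G}) :
  (forall v : G, #|neighbors v| < t) -> monopoly t M -> M = setT.
Proof.
move=> deg_lt /forallP monM; apply/setP => v; rewrite inE.
apply: contraTT (deg_lt v) => /(implyP (monM v)) t_le.
by rewrite -leqNgt (leq_trans t_le) // subset_leq_card // subsetIl.
Qed.

Lemma mon_gt_degree : (forall v : G, #|neighbors v| < t) -> mon G t = #|G|.
Proof.
move=> deg_lt; apply/eqP; rewrite eqn_leq -cardsT mon_leq ?monopolyT //=.
by apply: mon_geq => M /(monopoly_gt_degree deg_lt) ->.
Qed.

End MonopolySize.

Lemma card_neighbors_cart_setI (G H : sgraph) (M : {set cart_prod G H}) u v :
  #|neighbors (G := cart_prod G H) (u, v) :&: M|
    = #|neighbors v :&: row_set M u| + #|neighbors u :&: col_set M v|.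
Proof.
have inj_row : injective (pair u : H -> G * H) by move=> b b' [].
have inj_col : injective (fun a : G => (a, v)) by move=> a a' [].
set row_nbrs := _ :&: row_set M u; set col_nbrs := _ :&: col_set M v.
have row_colI : (pair u @: row_nbrs) :&: ((fun a => (a, v)) @: col_nbrs) = set0.
  apply/setP => -[a b]; rewrite !inE; apply/andP => -[].
  move=> /imsetP[b' b'_nbr [_ ->]] /imsetP[a' _ [_ b'_v]].
  by rewrite b'_v !inE adj_irrefl in b'_nbr.
rewrite -(card_imset _ inj_row) -(card_imset _ inj_col) -cardsUI row_colI.
rewrite cards0 addn0; apply: eq_card => -[a b]; rewrite !inE /= /cart_rel /=.
apply/andP/orP => [[/orP[] /andP[/eqP <- adj_ab] abM] | [] /imsetP[x]].
- by left; rewrite imset_f // !inE adj_ab.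
- by right; apply/imsetP; exists a; rewrite // !inE adj_ab.
- by rewrite !inE => /andP[adj_x xM] [-> ->]; rewrite eqxx adj_x.
- by rewrite !inE => /andP[adj_x xM] [-> ->]; rewrite eqxx adj_x orbT.
Qed.

Lemma card_neighbors_cart (G H : sgraph) u v :
  #|neighbors (G := cart_prod G H) (u, v)| = #|neighbors v| + #|neighbors u|.
Proof.
rewrite -[in LHS](setIT (neighbors _)) card_neighbors_cart_setI.
by rewrite row_setT col_setT !setIT.
Qed.

Lemma neighbors_complete n (u : complete_graph n) : neighbors u = [set~ u].
Proof. by apply/setP => v; rewrite !inE eq_sym. Qed.

Section RookGraph.
Variable n : nat.

Definition rook_graph : sgraph :=
  cart_prod (complete_graph n) (complete_graph n).

Lemma card_rook_graph : #|rook_graph| = n * n.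
Proof. by rewrite card_prod card_ord. Qed.

Lemma card_neighbors_rook (p : rook_graph) : #|neighbors p| = 2 * n.-1.
Proof.
case: p => i j; rewrite card_neighbors_cart !neighbors_complete.
by rewrite !cardsC1 !card_ord addnn mul2n.
Qed.

Lemma monopoly_rookP t (M : {set rook_graph}) :
  reflect (cross_dominating t M) (monopoly t M).
Proof.
have neighborsE i j : (i, j) \notin M ->
    #|neighbors (G := rook_graph) (i, j) :&: M|
      = #|row_set M i| + #|col_set M j|.
  move=> ijM; rewrite card_neighbors_cart_setI !neighbors_complete.
  by rewrite !(setIC [set~ _]) -!setDE !(setDidPl _) // disjoint_sym
    disjoints1 inE.
apply: (iffP forallP) => [monM i j ijM | domM [i j]].
  by rewrite -neighborsE //; apply: (implyP (monM (i, j))).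
by apply/implyP => ijM; rewrite neighborsE //; apply: domM.
Qed.

Lemma mon_rook_leq s t : s <= n -> t <= 2 * s -> mon rook_graph t <= n * s.
Proof.
move=> s_n t_s; have [M [rowM colM]] := exists_regular_set s_n.
have -> : n * s = #|M|.
  rewrite card_sum_row_set (eq_bigr (fun=> s)) => [|i _]; last exact: rowM.
  by rewrite sum_nat_const card_ord.
apply: mon_leq; apply/monopoly_rookP => i j _.
by rewrite rowM colM addnn -mul2n.
Qed.

Lemma mon_rook_geq t : t <= n -> n * t <= 2 * mon rook_graph t.
Proof.
move=> t_n; have [[M /monopoly_rookP domM <-] _] := monP rook_graph t.
by have := leq_card_cross_dominating _ domM; rewrite card_ord minnn; apply.
Qed.

Lemma mon_rook_double s : 2 * s <= n -> mon rook_graph (2 * s) = n * s.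
Proof.
move=> s_n; apply/eqP; rewrite eqn_leq mon_rook_leq //=; last by lia.
by have := mon_rook_geq s_n; rewrite mulnCA leq_pmul2l.
Qed.

Lemma mon_rook_full : 0 < n -> mon rook_graph (2 * n) = n * n.
Proof.
move=> n_gt0; rewrite mon_gt_degree ?card_rook_graph // => p.
by rewrite card_neighbors_rook; lia.
Qed.

Lemma mon_rook_codouble s :
  s <= n -> mon rook_graph (2 * n - 2 * s) = n * (n - s).
Proof.
move=> s_n; apply/eqP; rewrite eqn_leq mon_rook_leq ?leq_subr ?mulnBr //=.
apply: mon_geq => M /monopoly_rookP domM.
case: (posnP n) => [n0 | n_gt0]; first by rewrite [X in X * _]n0.
have setC_leq : #|~: M| <= n * s.
  have := @leq_cardC_cross_dominating _ _ M (2 * s).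
  rewrite card_ord addnn -mul2n => /(_ domM).
  have -> : 2 * s * (n * n) = n * s * (2 * n) by lia.
  by rewrite leq_pmul2r // muln_gt0.
by rewrite -card_rook_graph -(cardsC M) leq_subLR addnC leq_add2r.
Qed.

End RookGraph.

Theorem theorem3 :
  [/\ forall n : nat, 2 <= n ->
        mon (cart_prod (complete_graph n) (complete_graph n)) 2 = n,
      forall k t n : nat, 0 < k -> 0 < t -> ~~ odd t -> n = k * (t %/ 2) ->
        mon (cart_prod (complete_graph n) (complete_graph n)) t
          = k * (t ^ 2 %/ 4)
    & forall k t n : nat, 0 < k -> 0 < t -> ~~ odd t -> n = k * (t %/ 2) ->
        mon (cart_prod (complete_graph n) (complete_graph n)) (2 * n - t)
          = k * (k - 1) * (t ^ 2 %/ 4)].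
Proof.
split=> [n n_ge2 | k t n k_gt0 t_gt0 | k t n k_gt0 _].
- by rewrite (@mon_rook_double n 1) ?muln1.
- rewrite -dvdn2 => /dvdnP[s t_eq]; move: t_gt0.
  rewrite t_eq mulnK // expnMn mulnK // muln_gt0 => /andP[s_gt0 _] n_eq.
  rewrite mulnA -n_eq mulnC; case: (leqP 2 k) => [k_gt1 | k_lt2].
    by apply: mon_rook_double; rewrite n_eq leq_mul2r k_gt1 orbT.
  have s_n : s = n by rewrite n_eq (_ : k = 1) ?mul1n //; lia.
  by rewrite s_n in s_gt0 *; apply: mon_rook_full.
- rewrite -dvdn2 => /dvdnP[s ->]; rewrite mulnK // expnMn mulnK // => n_eq.
  rewrite (mulnC s) mon_rook_codouble n_eq ?leq_pmull //.
  by rewrite -[X in _ - X]mul1n -mulnBl mulnACA.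
Qed.
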